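(* Let $\theta\in(0,1)$ and let $0<\alpha\le\beta<1$ be (known) numbers such that $\alpha n<\lfloor n\theta\rfloor<\beta n$ for all sufficiently large $n$. Let $X_1,X_2,\dots$ and $Y_1,Y_2,\dots$ be generated by two different stationary ergodic processes $\rho_X\ne\rho_Y$ with alphabet $A$. For each $n$ let $Z=(Z_1,\dots,Z_n)$ be the concatenation of $(X_1,\dots,X_{\lfloor n\theta\rfloor})$ and $(Y_1,\dots,Y_{n-\lfloor n\theta\rfloor})$, and let $$\hat\theta=\hat\theta(Z_1,\dots,Z_n):=\frac1n\operatorname{argmax}_{t\in[\alpha n,\beta n]}\hat d\big((Z_1,\dots,Z_t),(Z_{t+1},\dots,Z_n)\big),$$ the maximum being over integers $t$ in the indicated range. Then $\lim_{n\to\infty}|\hat\theta-\theta|=0$ almost surely.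
   Context: The alphabet $A$ is $\mathbb R$ or a finite set. A process is a probability measure on $A^\infty$ with its Borel sigma-algebra. For $\mathbf x=X_{1..n}\in A^n$ and measurable $B\subset A^k$, the frequency is $\nu(\mathbf x,B):=\frac1{n-k+1}\sum_{i=1}^{n-k+1}\mathbf 1\{(X_i,\dots,X_{i+k-1})\in B\}$ if $n\ge k$, and $0$ otherwise. A process $\rho$ is stationary if $\rho(X_{1..j}\in B)=\rho(X_{i..i+j-1}\in B)$ for all $i,j\ge1$ and measurable $B\subset A^j$; it is ergodic if for every $k$ and measurable $B\subset A^k$ the frequency $\nu(X_{1..n},B)$ converges $\rho$-almost surely to a constant; it is stationary ergodic if it is both. Let $w_k:=1/(k(k+1))$. The empirical distributional distance is: for finite $A$, $\hat d(\mathbf x,\mathbf y):=\sum_{k=1}^\infty w_k\sum_{B\in A^k}|\nu(\mathbf x,B)-\nu(\mathbf y,B)|$; for $A=\mathbb R$, $\hat d(\mathbf x,\mathbf y):=\sum_{m,l=1}^\infty w_mw_l\sum_{B\in B^{m,l}}|\nu(\mathbf x,B)-\nu(\mathbf y,B)|$, where $B^{m,l}$ is the partition of $\mathbb R^m$ into cubes of dimension $m$ and volume $2^{-ml}$ (side $2^{-l}$), starting at the origin. Ties in the argmax are broken arbitrarily. *)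

(* Defs.v *)
From HB Require Import structures.
From mathcomp Require Import all_boot all_order all_algebra.
From mathcomp Require Import all_classical all_reals all_analysis.

Set Implicit Arguments.
Unset Strict Implicit.
Unset Printing Implicit Defensive.

Import Order.TTheory GRing.Theory Num.Theory.
Import numFieldNormedType.Exports.

Local Open Scope classical_set_scope.
Local Open Scope ring_scope.

Notation borel T := (g_sigma_algebraType (@open T)).

(* A^k and A^oo, with the product topology.  All indices start at 0: the
   letter X_i is [x i.-1]. *)
Notation word A k := {ptws 'I_k -> A}.
Notation trajectory A := {ptws nat -> A}.

Section processes.
Context {A : ptopologicalType}.

Definition window (x : trajectory A) (i k : nat) : word A k :=
  fun j : 'I_k => x (i + j)%N.
Arguments window : clear implicits.

(* In the nontrivial branch [i + k <= size x], so that [window] never reads the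
   default value of [nth]. *)
Definition freq (R : realType) (k : nat) (x : seq A) (B : set (word A k)) : R :=
  if (k <= size x)%N then
    ((size x - k).+1%:R)^-1 *
    \sum_(i < (size x - k).+1) \1_B (window (nth point x) i k)
  else 0.

Context {R : realType}.
Implicit Types rho : probability (borel (trajectory A)) R.

Definition stationary rho : Prop :=
  forall (i j : nat) (B : set (borel (word A j))), (0 < j)%N -> measurable B ->
    rho [set x | B (window x 0 j)] = rho [set x | B (window x i j)].

Definition ergodic rho : Prop :=
  forall (k : nat) (B : set (borel (word A k))), (0 < k)%N -> measurable B ->
    exists c : R, {ae rho, forall x, freq R (mkseq x n) B @[n --> \oo] --> c}.

Definition stationary_ergodic rho : Prop := stationary rho /\ ergodic rho.

(* Leibniz equality of [probability] would also compare the values on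
   non-measurable sets. *)
Definition same_process rho1 rho2 : Prop :=
  forall B, measurable B -> rho1 B = rho2 B.

Definition generated_by d (T : measurableType d) (P : probability T R)
    (X : {mfun T >-> borel (trajectory A)}) rho : Prop :=
  forall B, measurable B -> distribution P X B = rho B.

End processes.

(* A finite alphabet is a nonempty finite set; there is no process over the
   empty one. *)
Inductive alphabet : Type :=
| RealAlphabet
| FiniteAlphabet (F : pdiscreteTopologicalType) of finite_set [set: F].

Section distributional_distance.
Context {R : realType}.

Definition letter (a : alphabet) : ptopologicalType :=
  match a with
  | RealAlphabet => R
  | FiniteAlphabet F _ => F
  end.

Definition weight (k : nat) : R := (k * k.+1)%N%:R^-1.

Local Open Scope ereal_scope.

Definition dhat_finite (F : pdiscreteTopologicalType) (x y : seq F) : \bar R :=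
  \sum_(1 <= k <oo) (weight k)%:E *
    (\sum_(b \in [set: word F k]) `|freq R x [set b] - freq R y [set b]|)%:E.

Definition cube (m l : nat) (c : 'I_m -> int) : set (word R m) :=
  [set v | forall i,
    ((c i)%:~R / 2 ^+ l <= v i < (c i + 1)%:~R / 2 ^+ l)%R].
Arguments cube : clear implicits.

Definition cubes (m l : nat) : set (set (word R m)) := range (cube m l).
Arguments cubes : clear implicits.

Definition dhat_real (x y : seq R) : \bar R :=
  \sum_(1 <= m <oo) \sum_(1 <= l <oo) (weight m * weight l)%:E *
    \esum_(B in cubes m l) `|freq R x B - freq R y B|%:E.

Definition dhat (a : alphabet) : seq (letter a) -> seq (letter a) -> \bar R :=
  match a with
  | RealAlphabet => dhat_real
  | FiniteAlphabet F _ => @dhat_finite F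
  end.

End distributional_distance.

Section change_point.
Context {R : realType} (a : alphabet).
Implicit Types (z : seq (@letter R a)) (alpha beta theta : R).

Definition admissible alpha beta (n t : nat) : Prop :=
  alpha * n%:R <= t%:R <= beta * n%:R.

Definition is_argmax alpha beta z (t : nat) : Prop :=
  admissible alpha beta (size z) t /\
  forall s, admissible alpha beta (size z) s ->
    (dhat (take s z) (drop s z) <= dhat (take t z) (drop t z))%E.

(* [tau] picks a maximiser for every sample, ties being broken arbitrarily.  It
   is unconstrained on the (short) samples for which no integer is admissible. *)
Definition argmax_rule alpha beta (tau : seq (@letter R a) -> nat) : Prop :=
  forall z, (exists t, admissible alpha beta (size z) t) ->
    is_argmax alpha beta z (tau z).

Definition theta_hat (tau : seq (@letter R a) -> nat) z : R :=
  (tau z)%:R / (size z)%:R.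

Definition change_index theta (n : nat) : nat := Num.truncn (n%:R * theta).

Definition sample theta (x y : trajectory (@letter R a)) (n : nat) :
    seq (@letter R a) :=
  mkseq x (change_index theta n) ++ mkseq y (n - change_index theta n).

End change_point.

(* Main.v *)
Require Import Defs.
From HB Require Import structures.
From mathcomp Require Import all_boot all_order all_algebra.
From mathcomp Require Import all_classical all_reals all_analysis.
From mathcomp Require Import measurable_realfun finmap ring lra zify.

Import Order.TTheory GRing.Theory Num.Theory.
Import numFieldNormedType.Exports.

Local Open Scope classical_set_scope.
Local Open Scope ring_scope.

(** Only the frequencies of countably many cells matter: the words of each length
    for a finite alphabet, the dyadic cubes of each dimension and side for the
    reals.  A [coding] labels every block of a fixed length by the cell it lies
    in, so each trajectory becomes a sequence of symbols, and the empirical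
    distance is a weighted sum, over the codings, of the l1 distances between two
    vectors of symbol frequencies ([dhat_finiteE], [dhat_realE]).

    By ergodicity and stationarity the frequency of every symbol converges, almost
    surely, to its probability ([symbols_lln]); since the probabilities of the
    symbols sum to one, Scheffe's lemma upgrades this to convergence in l1, even
    when there are infinitely many symbols.  Hence the vector of counts in the
    first [s] windows is within [e * s + K] of [s] times the law
    ([l1norm_occ_linear]), and no uniformity in [s] has to be proved separately.

    Everything then takes place on one trajectory.  Up to boundary effects the
    counts of a split of the sample are sums and differences of such prefix counts,
    so the two parts differ, in l1, by [g * (pX - pY)] up to [o(n)/n], where the
    [contrast] [g] is the proportion of the law change that the split still sees:
    it is [1] at the change point and loses at least [|t - tau| / n] elsewhere
    ([split_block_freq], [dist_le_contrast]).  Dominated convergence over the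
    codings ([split_error_cvg0]) sums this up: with [D] the distance between the
    two laws, the split at [t] has distance at most [g * D + o(1)] and the split at
    the change point at least [D - o(1)].  A maximiser thus satisfies
    [|t - tau| / n * D <= o(1)] ([split_near_change]).  Finally [D > 0], because
    the cells generate the Borel sets and determine a process
    ([fibers_determine_measure], [law_dist_gt0]). *)

(** * Sums over arbitrary index sets *)

Lemma esumZ_le (R : realType) (T : choiceType) (D : set T) (r : R)
    (a : T -> \bar R) : 0 <= r -> (forall i, 0 <= a i)%E ->
  (\esum_(i in D) (r%:E * a i) <= r%:E * \esum_(i in D) a i)%E.
Proof.
move=> r0 a0; apply: ge_ereal_sup => _ [X XD <-].
rewrite -ge0_mule_fsumr//; apply: lee_wpmul2l; first by rewrite lee_fin.
by apply: ereal_sup_ubound; exists X.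
Qed.

Lemma le_esum_term (R : realType) (T : choiceType) (a : T -> \bar R) i :
  (a i <= \esum_(j in [set: T]) a j)%E.
Proof. by apply: esum_ge; exists [set i]; [split|rewrite fsbig_set1]. Qed.

Lemma esum_tail (R : realType) (T : choiceType) (b : T -> \bar R) (e : R) :
    (forall i, 0 <= b i)%E -> (\esum_(i in [set: T]) b i < +oo)%E -> 0 < e ->
  exists2 F : set T, finite_set F & (\esum_(i in ~` F) b i <= e%:E)%E.
Proof.
move=> b0 boo e0.
have bfin : \esum_(i in [set: T]) b i \is a fin_num.
  by rewrite ge0_fin_numE// esum_ge0.
have [_ [F [finF _] <-]] := ub_ereal_sup_adherent e0 bfin.
rewrite -/(esum setT b) => Fe; exists F => //.
move: bfin Fe; rewrite (esumID F)// setTI setTI esum_fset//.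
have := esum_ge0 (fun i (_ : (~` F) i) => b0 i).
have := fsume_ge0 (fun i (_ : F i) => b0 i).
case: (\sum_(_ \in _) _)%E => [s| |]; case: (esum _ _) => [t| |]//.
by rewrite -EFinD -EFinN -EFinD lte_fin !lee_fin => _ _ _ ste; lra.
Qed.

(** Dominated convergence for sums: outside a finite set the dominating family is
    small, and a finite sum of small terms is small. *)
Lemma esum_dominated_cvg0 (R : realType) (T : choiceType)
    (a : nat -> T -> \bar R) (b : T -> \bar R) :
    (forall n i, 0 <= a n i)%E -> (forall n i, a n i <= b i)%E ->
    (\esum_(i in [set: T]) b i < +oo)%E ->
    (forall i (e : R), 0 < e -> \forall n \near \oo, (a n i <= e%:E)%E) ->
  forall e : R, 0 < e -> \forall n \near \oo, (\esum_(i in [set: T]) a n i <= e%:E)%E.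
Proof.
move=> a0 ab boo ai e e0.
have b0 i : (0 <= b i)%E by apply: le_trans (a0 0%N i) (ab _ _).
have e20 : 0 < e / 2 by lra.
have [_ /finite_fsetP[A ->] Fe] := esum_tail _ _ _ _ b0 boo e20.
(* The successor only avoids a division by zero when the finite set is empty. *)
pose dl := e / 2 / (size (enum_fset A)).+1%:R.
have dl0 : 0 < dl by rewrite divr_gt0.
have nA : \forall n \near \oo, (\bigcap_(i in [set` A])
    [set m | a m i <= dl%:E]%E) n.
  by apply: filter_bigI => i _; exact: ai.
near=> n.
rewrite (esumID [set` A])// setTI setTI esum_fset// (splitr e) EFinD leeD//.
  rewrite fsbig_finite//= set_fsetK.
  apply: (@le_trans _ _ (\sum_(i <- A) dl%:E)%E).
    rewrite [leLHS]big_seq [leRHS]big_seq; apply: lee_sum => i iA.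
    by apply: (near nA n).
  rewrite sumEFin big_const_seq count_predT iter_addr addr0 lee_fin.
  rewrite -(mulr_natr dl) /dl -mulrA ler_piMr//; first lra.
  by rewrite mulrC ler_pdivrMr// mul1r ler_nat.
by apply: le_trans Fe; apply: le_esum => i _; exact: ab.
Unshelve. all: end_near. Qed.

(** * The l1 norm and Scheffe's lemma *)

Section l1norm.
Context {R : realType} {T : choiceType}.
Implicit Types f g : T -> R.

Definition l1norm f : \bar R := (\esum_(c in [set: T]) `|f c|%:E)%E.

Lemma l1norm_ge0 f : (0 <= l1norm f)%E.
Proof. by apply: esum_ge0 => c _; rewrite lee_fin. Qed.

Lemma eq_l1norm f g : f =1 g -> l1norm f = l1norm g.
Proof. by move=> fg; apply: eq_esum => c _; rewrite fg. Qed.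

Lemma l1normD f g : (l1norm (fun c => (f c + g c)%R) <= l1norm f + l1norm g)%E.
Proof.
rewrite /l1norm -esumD; try by move=> *; rewrite lee_fin.
by apply: le_esum => c _; rewrite -EFinD lee_fin ler_normD.
Qed.

Lemma l1normZ k f : (l1norm (fun c => (k * f c)%R) <= `|k|%:E * l1norm f)%E.
Proof.
rewrite /l1norm (eq_esum (fun c _ => congr1 EFin (normrM k (f c)))).
under eq_esum do rewrite EFinM.
exact: esumZ_le.
Qed.

Lemma l1normD_le f g (r s : R) : (l1norm f <= r%:E)%E -> (l1norm g <= s%:E)%E ->
  (l1norm (fun c => (f c + g c)%R) <= (r + s)%:E)%E.
Proof. by move=> fr gs; rewrite EFinD (le_trans (l1normD f g))// leeD. Qed.

Lemma l1normN f : l1norm (fun c => - f c)%R = l1norm f.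
Proof. by apply: eq_esum => c _; rewrite normrN. Qed.

Lemma l1normB_le f g (r s : R) : (l1norm f <= r%:E)%E -> (l1norm g <= s%:E)%E ->
  (l1norm (fun c => (f c - g c)%R) <= (r + s)%:E)%E.
Proof. by move=> fr gs; apply: l1normD_le; rewrite ?l1normN. Qed.

Lemma l1normZ_le k f (r : R) : (l1norm f <= r%:E)%E ->
  (l1norm (fun c => (k * f c)%R) <= (`|k| * r)%:E)%E.
Proof. by move=> fr; rewrite EFinM (le_trans (l1normZ k f))// lee_wpmul2l. Qed.

Lemma l1norm0 : l1norm (fun=> 0%R) = 0%E.
Proof. by apply: esum1 => c _; rewrite normr0. Qed.

Lemma l1norm_le_eq0 f c : (l1norm f <= 0)%E -> f c = 0.
Proof.
move=> f0; apply/eqP; rewrite -normr_le0 -lee_fin; apply: le_trans f0.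
exact: (le_esum_term _ _ (fun c => `|f c|%:E)).
Qed.

Lemma l1norm_delta (x : T) : l1norm (fun c => (x == c)%:R) = 1%E.
Proof.
rewrite /l1norm (esumID [set x])// setTI setTI esum_set1 ?lee_fin//.
rewrite eqxx normr1 esum1 ?adde0// => c /= /eqP; rewrite eq_sym => /negPf->.
by rewrite normr0.
Qed.

(** Scheffe's lemma.  Since [|q - p| = 2 (p - q)^+ + (q - p)] and the total mass of
    [q] does not exceed that of [p], it is enough to bound the sum of the
    [(p - q)^+], which is dominated by [p]. *)
Lemma scheffe (p : T -> R) (q : nat -> T -> R) :
    (forall c, 0 <= p c) -> (l1norm p = 1)%E ->
    (forall n c, 0 <= q n c) -> (forall n, l1norm (q n) <= 1)%E ->
    (forall c, q n c @[n --> \oo] --> p c) ->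
  forall e : R, 0 < e ->
    \forall n \near \oo, (l1norm (fun c => (q n c - p c)%R) <= e%:E)%E.
Proof.
move=> p0 p1 q0 q1 qp e e0.
pose d n c := Num.max (p c - q n c) 0.
have d0 n c : 0 <= d n c by rewrite le_max lexx orbT.
have dp n c : d n c <= p c by rewrite ge_max p0 lerBlDr lerDl q0.
have small : \forall n \near \oo, (\esum_(c in [set: T]) (d n c)%:E <= (e / 2)%:E)%E.
  apply: (@esum_dominated_cvg0 _ _ (fun n c => (d n c)%:E) (fun c => `|p c|%:E)).
  - by move=> n c; rewrite lee_fin.
  - by move=> n c; rewrite lee_fin (ger0_norm (p0 c)).
  - by rewrite -/(l1norm p) p1 ltry.
  - move=> c e' e'0.
    have /cvgr_dist_le/(_ e' e'0) := qp c; apply: filterS => n pq.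
    by rewrite lee_fin ge_max (ltW e'0) andbT (le_trans (ler_norm _)).
  - by lra.
apply: filterS small => n dn.
have : (l1norm (fun c => (q n c - p c)%R) + l1norm p <=
        (2 : R)%:E * (e / 2)%:E + l1norm (q n))%E.
  apply: (@le_trans _ _ ((2 : R)%:E * (\esum_(c in [set: T]) (d n c)%:E) + l1norm (q n))%E); last first.
    by rewrite leeD2r// lee_wpmul2l// lee_fin.
  apply: (@le_trans _ _ (\esum_(c in [set: T]) ((2 : R)%:E * (d n c)%:E) + l1norm (q n))%E); last first.
    by rewrite leeD2r//; apply: esumZ_le => // c; rewrite lee_fin.
  rewrite /l1norm -!esumD; try by move=> *; rewrite lee_fin ?mulr_ge0.
  apply: le_esum => c _; rewrite -EFinM -!EFinD lee_fin.
  rewrite (ger0_norm (p0 c)) (ger0_norm (q0 n c)).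
  have : p c - q n c <= d n c by rewrite le_max lexx.
  by have := d0 n c; case: ler0P => _; lra.
rewrite p1 => /le_trans/(_ (leeD2l _ (q1 n))).
rewrite leeD2rE// => /le_trans; apply.
by rewrite -EFinM lee_fin; lra.
Qed.

End l1norm.
(** * Counting symbols *)

Section occurrences.
Context {R : realType} {T : choiceType}.
Implicit Types (s : nat -> T) (p : T -> R).

Definition occ s n c : R := \sum_(i < n) (s i == c)%:R.

(** The frequency of a symbol in a sample of [t] letters, each symbol being read
    off a window of [k] letters. *)
Definition block_freq (k : nat) s t c : R :=
  if (k <= t)%N then ((t - k).+1%:R)^-1 * occ s (t - k).+1 c else 0.

Lemma occS s n c : occ s n.+1 c = occ s n c + (s n == c)%:R.
Proof. by rewrite /occ big_ord_recr. Qed.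

Lemma occ0 s c : occ s 0 c = 0.
Proof. by rewrite /occ big_ord0. Qed.

Lemma occD s m n c : occ s (m + n) c = occ s m c + occ (fun i => s (m + i)%N) n c.
Proof. by rewrite /occ big_split_ord. Qed.

Lemma occ_ge0 s n c : 0 <= occ s n c.
Proof. exact: sumr_ge0. Qed.

Lemma l1norm_occ s n : (l1norm (occ s n) <= n%:R%:E)%E.
Proof.
elim: n => [|n IHn].
  by rewrite (eq_l1norm _ (fun=> 0)) ?l1norm0// => c; rewrite occ0.
rewrite (eq_l1norm _ _ (occS s n)) -natr1.
by apply: l1normD_le => //; rewrite l1norm_delta.
Qed.

(** Each index where the sequences disagree contributes at most two. *)
Lemma l1norm_occB s s' a n : (forall i, (i < a)%N -> s i = s' i) ->
  (l1norm (fun c => occ s n c - occ s' n c)%R <= (2 * (n - a)%:R)%:E)%E.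
Proof.
move=> ss'; elim: n => [|n IHn].
  by rewrite (eq_l1norm _ (fun=> 0)) ?l1norm0 ?mulr0// => c; rewrite !occ0 subr0.
have [na|an] := ltnP n a.
  rewrite (eq_l1norm _ (fun c => occ s n c - occ s' n c)); last first.
    by move=> c; rewrite !occS (ss' n na); ring.
  by apply: (le_trans IHn); rewrite lee_fin ler_pM2l// ler_nat leq_sub2r.
rewrite (eq_l1norm _ (fun c => (occ s n c - occ s' n c) +
    ((s n == c)%:R - (s' n == c)%:R))); last by move=> c; rewrite !occS; ring.
rewrite subSn// -[(n - a).+1%:R]natr1 mulrDr mulr1.
apply: l1normD_le => //; rewrite (_ : 2 = 1 + 1)//.
by apply: l1normB_le; rewrite l1norm_delta.
Qed.

(** The frequency of a word of length [k] in [t] letters counts only the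
    [t - k + 1] windows that fit; comparing with all the [t] windows of a longer
    sequence moves the empirical measure by [O(k / t)]. *)
Lemma block_freq_approx k s t : (0 < k)%N -> (0 < t)%N ->
  (l1norm (fun c => block_freq k s t c - t%:R^-1 * occ s t c)%R
     <= (2 * k%:R / t%:R)%:E)%E.
Proof.
move=> k0 t0; have t0' : (0 : R) < t%:R by rewrite ltr0n.
rewrite /block_freq; case: leqP => kt; last first.
  rewrite (eq_l1norm _ (fun c => - t%:R^-1 * occ s t c)); last first.
    by move=> c; rewrite sub0r mulNr.
  apply: le_trans (l1normZ_le _ _ _ (l1norm_occ s t)) _.
  rewrite normrN ger0_norm ?invr_ge0// mulVf ?gt_eqF// lee_fin.
  rewrite ler_pdivlMr// mul1r.
  have : (t%:R : R) <= k%:R by rewrite ler_nat ltnW.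
  by lra.
set r := (t - k).+1.
have -> : t = (r + (k - 1))%N by lia.
have r0' : (0 : R) < r%:R by rewrite ltr0n.
move: t0'; rewrite (_ : t = (r + (k - 1))%N); last lia.
set d := (k - 1)%N => rd0.
rewrite (eq_l1norm _ (fun c => (d%:R / (r%:R * (r + d)%:R)) * occ s r c
    - (r + d)%:R^-1 * occ (fun i => s (r + i)%N) d c)); last first.
  move=> c; rewrite occD natrD; field.
  by rewrite -natrD !pnatr_eq0.
apply: le_trans (l1normB_le _ _ _ _ (l1normZ_le _ _ _ (l1norm_occ _ _))
  (l1normZ_le _ _ _ (l1norm_occ _ _))) _.
rewrite lee_fin !ger0_norm ?invr_ge0 ?divr_ge0 ?mulr_ge0//.
have -> : d%:R / (r%:R * (r + d)%:R) * r%:R = d%:R / (r + d)%:R :> R.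
  by rewrite natrD; field; rewrite -natrD !pnatr_eq0.
rewrite [_^-1 * _]mulrC -mulrDl ler_pM2r ?invr_gt0//.
have : (d%:R : R) <= k%:R by rewrite ler_nat /d leq_subr.
by lra.
Qed.

(** By Scheffe's lemma the symbol frequencies converge in l1; the counts of the
    finitely many prefixes before the rate [e] is reached go into the constant. *)
Lemma l1norm_occ_linear s p : (forall c, 0 <= p c) -> (l1norm p = 1)%E ->
    (forall c, n%:R^-1 * occ s n c @[n --> \oo] --> p c) ->
  forall e : R, 0 < e -> exists2 K : R, 0 <= K &
    forall n, (l1norm (fun c => occ s n c - n%:R * p c)%R <= (e * n%:R + K)%:E)%E.
Proof.
move=> p0 p1 sp e e0.
have [||N _ NP] := scheffe p (fun n c => n%:R^-1 * occ s n c) p0 p1 _ _ sp e e0.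
- by move=> n c; rewrite mulr_ge0 ?invr_ge0 ?occ_ge0.
- move=> n; apply: le_trans (l1normZ_le _ _ _ (l1norm_occ s n)) _.
  rewrite ger0_norm ?invr_ge0// lee_fin.
  by case: n => [|n]; rewrite ?mulr0// mulVf ?pnatr_eq0.
(* A prefix shorter than [N] is bounded trivially: both terms have norm at most [N]. *)
exists (2 * N%:R); first by rewrite mulr_ge0.
move=> n; have [Nn|nN] := leqP N n; last first.
  have p1' : (l1norm p <= 1%:E)%E by rewrite p1.
  apply: le_trans (l1normB_le _ _ _ _ (l1norm_occ s n) (l1normZ_le _ _ _ p1')) _.
  rewrite lee_fin normr_nat mulr1.
  have : (n%:R : R) <= N%:R by rewrite ler_nat ltnW.
  have : 0 <= e * n%:R by rewrite mulr_ge0// ltW.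
  by lra.
have [->|n0] := posnP n.
  rewrite (eq_l1norm _ (fun=> 0)); last by move=> c; rewrite occ0 mul0r subr0.
  by rewrite l1norm0 lee_fin mulr0 add0r mulr_ge0.
rewrite (eq_l1norm _ (fun c => n%:R * (n%:R^-1 * occ s n c - p c))); last first.
  by move=> c; field; rewrite pnatr_eq0 -lt0n.
apply: le_trans (l1normZ_le _ _ _ (NP n Nn)) _.
by rewrite normr_nat lee_fin mulrC lerDl mulr_ge0.
Qed.

End occurrences.

(** * Spliced sequences *)

Section splicing.
Context {R : realType} {T : choiceType}.
Variables (k tau : nat) (sx sy sz : nat -> T) (pX pY : T -> R).
Hypothesis szX : forall i, (i + k <= tau)%N -> sz i = sx i.
Hypothesis szY : forall i, sz (tau + i)%N = sy i.

(** Only the fewer than [k] windows straddling the change point [tau] are neither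
    windows of [x] nor windows of [y]. *)
Lemma l1norm_occ_splice n :
  (l1norm (fun c => occ sz n c - (occ sx (minn n tau) c + occ sy (n - tau) c))%R
     <= (2 * k%:R : R)%:E)%E.
Proof using szX szY.
have [ntau|taun] := leqP n tau.
  have n0 : (n - tau = 0)%N by apply/eqP; rewrite subn_eq0.
  rewrite n0.
  rewrite (eq_l1norm _ (fun c => occ sz n c - occ sx n c)); last first.
    by move=> c; rewrite occ0 addr0.
  apply: le_trans (l1norm_occB _ _ (tau.+1 - k) n _) _.
    by move=> i ik; apply: szX; lia.
  by rewrite lee_fin ler_pM2l// ler_nat; lia.
rewrite -{1}(subnKC (ltnW taun)).
rewrite (eq_l1norm _ (fun c => occ sz tau c - occ sx tau c)); last first.
  move=> c; rewrite occD (_ : (fun i => sz (tau + i)%N) = sy); first by ring.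
  by apply/funext => i; exact: szY.
apply: le_trans (l1norm_occB _ _ (tau.+1 - k) tau _) _.
  by move=> i ik; apply: szX; lia.
by rewrite lee_fin ler_pM2l// ler_nat; lia.
Qed.

(** The expected count vector of the first [n] windows of the spliced sequence. *)
Definition mean_occ n c : R := (minn n tau)%:R * pX c + (n - tau)%:R * pY c.

Lemma l1norm_occ_mean (e K : R) n N : 0 <= e -> (n <= N)%N ->
    (forall m, l1norm (fun c => occ sx m c - m%:R * pX c)%R <= (e * m%:R + K)%:E)%E ->
    (forall m, l1norm (fun c => occ sy m c - m%:R * pY c)%R <= (e * m%:R + K)%:E)%E ->
  (l1norm (fun c => occ sz n c - mean_occ n c)%R
     <= (2 * k%:R + 2 * (e * N%:R + K))%:E)%E.
Proof using szX szY.
move=> e0 nN EX EY.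
have mono m : (m <= N)%N -> e * m%:R + K <= e * N%:R + K.
  by move=> mN; rewrite lerD2r ler_wpM2l// ler_nat.
rewrite (eq_l1norm _ (fun c =>
  (occ sz n c - (occ sx (minn n tau) c + occ sy (n - tau) c)) +
  ((occ sx (minn n tau) c - (minn n tau)%:R * pX c) +
   (occ sy (n - tau) c - (n - tau)%:R * pY c)))); last first.
  by move=> c; rewrite /mean_occ; ring.
apply: l1normD_le; first exact: l1norm_occ_splice.
rewrite mulr_natl mulr2n; apply: l1normD_le.
  by apply: le_trans (EX _) _; rewrite lee_fin mono//; lia.
by apply: le_trans (EY _) _; rewrite lee_fin mono//; lia.
Qed.

(** The weight of the difference between the two laws that a split at [t] still
    sees: the side of [t] containing the change point is a mixture. *)
Definition contrast n t : R :=
  if (t <= tau)%N then (n - tau)%:R / (n - t)%:R else tau%:R / t%:R.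

Lemma mean_occ_contrast n t c : (tau <= n)%N -> (0 < t < n)%N ->
  t%:R^-1 * mean_occ t c - (n - t)%:R^-1 * (mean_occ n c - mean_occ t c) =
  contrast n t * (pX c - pY c).
Proof using.
move=> taun /andP[t0 tn].
have t0' : t%:R != 0 :> R by rewrite pnatr_eq0 -lt0n.
have nt0 : n%:R - t%:R != 0 :> R.
  by rewrite subr_eq0 eqr_nat gtn_eqF.
rewrite /mean_occ /contrast (minn_idPr taun) (natrB _ taun) (natrB _ (ltnW tn)).
case: leqP => ttau.
  rewrite (_ : (t - tau = 0)%N); last by lia.
  by field; rewrite t0' nt0.
by rewrite (natrB _ (ltnW ttau)); field; rewrite t0' nt0.
Qed.

(** Both parts have symbol counts that are prefix counts of the spliced sequence or
    differences of such, divided by lengths of at least [m].  Replacing every count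
    by its mean leaves [contrast * (pX - pY)], by [mean_occ_contrast]; the error
    collects two boundary effects of size [2 k] and three prefix estimates. *)
Lemma split_block_freq (e K m : R) n t : (0 < k)%N ->
    0 <= e -> 0 <= K -> (tau <= n)%N -> 0 < m -> m <= t%:R -> (t <= n)%N -> m <= (n - t)%:R ->
    (forall j, l1norm (fun c => occ sx j c - j%:R * pX c)%R <= (e * j%:R + K)%:E)%E ->
    (forall j, l1norm (fun c => occ sy j c - j%:R * pY c)%R <= (e * j%:R + K)%:E)%E ->
  (l1norm (fun c => block_freq k sz t c
                    - block_freq k (fun i => sz (t + i)%N) (n - t) c
                    - contrast n t * (pX c - pY c))%R
     <= ((10 * k%:R + 6 * (e * n%:R + K)) / m)%:E)%E.
Proof using szX szY.
move=> k_gt0 e0 K0 taun m0 mt tn mnt EX EY.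
have t0' : (0 : R) < t%:R by lra.
have nt0' : (0 : R) < (n - t)%:R by lra.
have t0 : (0 < t)%N by move: t0'; rewrite ltr0n.
have nt0 : (0 < n - t)%N by move: nt0'; rewrite ltr0n.
have le_m a b : 0 <= a -> m <= b -> b^-1 * a <= a / m.
  move=> a0 mb; rewrite mulrC ler_wpM2l// lef_pV2 ?posrE//.
  exact: lt_le_trans mb.
pose D := 2 * k%:R + 2 * (e * n%:R + K).
have D0 : 0 <= D by rewrite addr_ge0 ?mulr_ge0 ?addr_ge0// mulr_ge0.
have k2 : 0 <= 2 * k%:R :> R by rewrite mulr_ge0.
have At := l1norm_occ_mean _ _ _ _ e0 tn EX EY; rewrite -/D in At.
have An := l1norm_occ_mean _ _ _ _ e0 (leqnn n) EX EY; rewrite -/D in An.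
rewrite (eq_l1norm _ (fun c =>
   ((block_freq k sz t c - t%:R^-1 * occ sz t c) +
   t%:R^-1 * (occ sz t c - mean_occ t c)) -
   ((block_freq k (fun i => sz (t + i)%N) (n - t) c -
      (n - t)%:R^-1 * occ (fun i => sz (t + i)%N) (n - t) c) +
    (n - t)%:R^-1 * ((occ sz n c - mean_occ n c) - (occ sz t c - mean_occ t c)))));
    last first.
  move=> c; rewrite -mean_occ_contrast//; last by lia.
  have -> : occ sz n c = occ sz t c + occ (fun i => sz (t + i)%N) (n - t) c.
    by move=> *; rewrite -occD subnKC.
  by ring.
have bt := @block_freq_approx R T _ sz _ k_gt0 t0.
have bnt := @block_freq_approx R T _ (fun i => sz (t + i)%N) _ k_gt0 nt0.
have left_side := l1normD_le _ _ _ _ bt (l1normZ_le t%:R^-1 _ _ At).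
have right_side := l1normD_le _ _ _ _ bnt
  (l1normZ_le (n - t)%:R^-1 _ _ (l1normB_le _ _ _ _ An At)).
apply: le_trans (l1normB_le _ _ _ _ left_side right_side) _.
rewrite lee_fin !ger0_norm ?invr_ge0//.
have := le_m _ _ k2 mt; have := le_m _ _ k2 mnt.
have := le_m _ _ D0 mt; have := le_m _ _ (addr_ge0 D0 D0) mnt.
rewrite -(mulrC (2 * k%:R) t%:R^-1) -(mulrC (2 * k%:R) _^-1).
have -> : (10 * k%:R + 6 * (e * n%:R + K)) / m =
  2 * k%:R / m + D / m + (2 * k%:R / m + (D + D) / m) by rewrite /D; ring.
by move=> *; rewrite !lerD.
Qed.

End splicing.
(** * Codings of trajectories *)

Lemma take_mkseq (A : Type) (z : nat -> A) t n : (t <= n)%N ->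
  take t (mkseq z n) = mkseq z t.
Proof. by move=> tn; rewrite /mkseq -map_take take_iota (minn_idPl tn). Qed.

Lemma drop_mkseq (A : Type) (z : nat -> A) t n :
  drop t (mkseq z n) = mkseq (fun i => z (t + i)%N) (n - t).
Proof. by rewrite /mkseq -map_drop drop_iota add0n -{1}(addn0 t) iotaDl -map_comp. Qed.

Section codings.
Context {A : ptopologicalType}.

(** A countable measurable partition of the words of a given length, presented by
    the map sending a word to the label of its cell. *)
Record coding := Coding {
  block : nat;
  symbol : choiceType;
  encode : word A block -> symbol;
  block_gt0 : (0 < block)%N;
  symbol_countable : countable [set: symbol];
  measurable_encode : forall c,
    measurable (encode @^-1` [set c] : set (borel (word A block))) }.

Definition cell (Q : coding) (c : symbol Q) : set (word A (block Q)) :=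
  encode Q @^-1` [set c].

Definition symbols (Q : coding) (x : nat -> A) (i : nat) : symbol Q :=
  encode Q (@window A x i (block Q)).

Definition splice (x y : nat -> A) tau (i : nat) : A :=
  if (i < tau)%N then x i else y (i - tau)%N.

Lemma mkseq_splice x y tau n : (tau <= n)%N ->
  mkseq x tau ++ mkseq y (n - tau) = mkseq (splice x y tau) n.
Proof.
move=> taun; rewrite -[in RHS](subnKC taun) /mkseq iotaD map_cat; congr cat.
  apply/eq_in_map => i; rewrite mem_iota /splice => /andP[_].
  by rewrite add0n => ->.
rewrite [(0 + tau)%N]addnC iotaDl -map_comp; apply: eq_map => i /=.
by rewrite /splice ltnNge leq_addr/= addKn.
Qed.

Lemma eq_window (x y : nat -> A) i k :
  (forall j, (j < k)%N -> x (i + j)%N = y (i + j)%N) ->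
  @window A x i k = @window A y i k.
Proof. by move=> xy; apply/funext => -[j jk]; exact: xy. Qed.

Lemma symbols_shift Q (x : nat -> A) t :
  symbols Q (fun i => x (t + i)%N) = fun i => symbols Q x (t + i)%N.
Proof.
apply/funext => i; rewrite /symbols; congr encode.
by apply/funext => j; rewrite /window addnA.
Qed.

Lemma symbols_splice_left Q x y tau i : (i + block Q <= tau)%N ->
  symbols Q (splice x y tau) i = symbols Q x i.
Proof.
move=> ik; rewrite /symbols; congr encode; apply: eq_window => j jk.
by rewrite /splice ifT//; lia.
Qed.

Lemma symbols_splice_right Q x y tau i :
  symbols Q (splice x y tau) (tau + i) = symbols Q y i.
Proof.
rewrite /symbols; congr encode; apply/funext => j.
by rewrite /window /splice -addnA ltnNge leq_addr/= addKn.
Qed.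

Lemma indic_cell {R : realType} Q c (w : word A (block Q)) :
  \1_(cell Q c) w = (encode Q w == c)%:R :> R.
Proof.
rewrite indicE; congr (_%:R); congr nat_of_bool.
by apply/idP/eqP => [/set_mem|wc] //; apply/mem_set.
Qed.

Lemma freq_cell {R : realType} Q (x : nat -> A) t c :
  freq R (mkseq x t) (cell Q c) = block_freq (block Q) (symbols Q x) t c.
Proof.
rewrite /freq /block_freq size_mkseq; case: leqP => // kt.
congr (_ * _); apply: eq_bigr => -[i it] _ /=; rewrite indic_cell.
congr ((_ == c)%:R); rewrite /symbols; congr encode.
by apply: eq_window => j jk; rewrite nth_mkseq//; lia.
Qed.

End codings.
Arguments coding : clear implicits.

Lemma l1norm_block_freq (R : realType) (T : choiceType) k (s : nat -> T) t :
  (l1norm (block_freq k s t : T -> R) <= 1%:E)%E.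
Proof.
rewrite /block_freq; case: leqP => _; last by rewrite l1norm0 lee_fin.
apply: le_trans (l1normZ_le _ _ _ (l1norm_occ _ _)) _.
by rewrite ger0_norm ?invr_ge0// mulVf ?pnatr_eq0.
Qed.

(** * The best split of a spliced sample *)

Section contrast.
Context {R : realType}.

Lemma contrast_ge0 tau n t : 0 <= contrast tau n t :> R.
Proof. by rewrite /contrast; case: ifP => _; rewrite divr_ge0. Qed.

Lemma ler_divn (a b : nat) : (a <= b)%N -> a%:R / b%:R <= 1 :> R.
Proof.
move=> ab; have [b0|b0] := posnP b; first by rewrite b0 invr0 mulr0.
by rewrite ler_pdivrMr ?ltr0n// mul1r ler_nat.
Qed.

Lemma contrast_le1 tau n t : contrast tau n t <= 1 :> R.
Proof. by rewrite /contrast; case: leqP => h; apply: ler_divn; lia. Qed.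

Lemma contrast_eq1 tau n : (tau < n)%N -> contrast tau n tau = 1 :> R.
Proof. by move=> h; rewrite /contrast leqnn divff// pnatr_eq0; lia. Qed.

(** One minus the contrast is [|t - tau|] over the length of the part that contains
    the change point, which is at most [n]. *)
Lemma dist_le_contrast tau n t : (0 < n)%N -> (tau <= n)%N -> (t <= n)%N ->
  `|t%:R - tau%:R| / n%:R <= 1 - contrast tau n t :> R.
Proof.
move=> n0 taun tn; have n0' : (0 : R) < n%:R by rewrite ltr0n.
rewrite /contrast; case: leqP => h.
  have -> : `|t%:R - tau%:R| = (tau - t)%:R :> R.
    by rewrite natrB// distrC ger0_norm// subr_ge0 ler_nat.
  have [nt|nt] := posnP (n - t); first by rewrite nt invr0 mulr0 subr0 ler_divn//; lia.
  have nt' : (0 : R) < (n - t)%:R by rewrite ltr0n.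
  have -> : 1 - (n - tau)%:R / (n - t)%:R = (tau - t)%:R / (n - t)%:R :> R.
    rewrite -{1}(divff (lt0r_neq0 nt')) -mulrBl -natrB; last lia.
    by congr (_%:R / _); lia.
  by rewrite ler_wpM2l// lef_pV2 ?posrE// ler_nat leq_subr.
have -> : `|t%:R - tau%:R| = (t - tau)%:R :> R.
  by rewrite (natrB _ (ltnW h)) ger0_norm// subr_ge0 ler_nat ltnW.
have t0' : (0 : R) < t%:R by rewrite ltr0n; lia.
have -> : 1 - tau%:R / t%:R = (t - tau)%:R / t%:R :> R.
  by rewrite -{1}(divff (lt0r_neq0 t0')) -mulrBl -natrB// ltnW.
by rewrite ler_wpM2l// lef_pV2 ?posrE// ler_nat.
Qed.

End contrast.

Section coded_distance.
Context {R : realType} {A : ptopologicalType} {J : choiceType}.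
Variables (q : J -> coding A) (u : J -> R).

Definition coded_dist (x y : seq A) : \bar R :=
  (\esum_(j in [set: J]) ((u j)%:E *
    l1norm (fun c => (freq R x (cell (q j) c) - freq R y (cell (q j) c))%R)))%E.

Definition law_dist (p p' : forall j, symbol (q j) -> R) : \bar R :=
  (\esum_(j in [set: J]) ((u j)%:E * l1norm (fun c => (p j c - p' j c)%R)))%E.

Hypothesis u_ge0 : forall j, 0 <= u j.
Hypothesis u_summable : (\esum_(j in [set: J]) (u j)%:E < +oo)%E.

Variables (x y : nat -> A) (pX pY : forall j, symbol (q j) -> R).
Hypotheses (pX_ge0 : forall j c, 0 <= pX j c) (pY_ge0 : forall j c, 0 <= pY j c).
Hypotheses (pX1 : forall j, (l1norm (pX j) = 1)%E) (pY1 : forall j, (l1norm (pY j) = 1)%E).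
Hypothesis X_lln : forall j c,
  n%:R^-1 * occ (symbols (q j) x) n c @[n --> \oo] --> pX j c.
Hypothesis Y_lln : forall j c,
  n%:R^-1 * occ (symbols (q j) y) n c @[n --> \oo] --> pY j c.

Variable tau : nat -> nat.
Hypothesis tau_le : forall n, (tau n <= n)%N.

Let z n := mkseq (splice x y (tau n)) n.

Definition split_error n t : \bar R :=
  (\esum_(j in [set: J]) ((u j)%:E * l1norm (fun c =>
     (freq R (take t (z n)) (cell (q j) c) - freq R (drop t (z n)) (cell (q j) c)
      - contrast (tau n) n t * (pX j c - pY j c))%R)))%E.

(** Linear bounds are summed in additive form, so that no finiteness is needed. *)
Lemma weighted_esum_le (f g h : J -> \bar R) (k : R) : 0 <= k ->
    (forall j, 0 <= g j)%E -> (forall j, 0 <= h j)%E ->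
    (forall j, f j <= k%:E * g j + h j)%E ->
  (\esum_(j in [set: J]) ((u j)%:E * f j) <=
   k%:E * (\esum_(j in [set: J]) ((u j)%:E * g j)) +
   \esum_(j in [set: J]) ((u j)%:E * h j))%E.
Proof using u_ge0.
move=> k0 g0 h0 fgh.
have ug j : (0 <= (u j)%:E * g j)%E by rewrite mule_ge0// lee_fin.
apply: (@le_trans _ _ (\esum_(j in [set: J]) (k%:E * ((u j)%:E * g j)) +
   \esum_(j in [set: J]) ((u j)%:E * h j))%E); last first.
  by rewrite leeD2r//; apply: esumZ_le.
rewrite -esumD; last 2 first.
- by move=> j _; rewrite mule_ge0// lee_fin.
- by move=> j _; rewrite mule_ge0// lee_fin.
apply: le_esum => j _.
apply: (@le_trans _ _ ((u j)%:E * (k%:E * g j + h j))%E).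
  by rewrite lee_wpmul2l// lee_fin.
by rewrite ge0_muleDr// ?mule_ge0 ?lee_fin// muleCA.
Qed.

Lemma coded_dist_le n t : (coded_dist (take t (z n)) (drop t (z n)) <=
  (contrast (tau n) n t)%:E * law_dist pX pY + split_error n t)%E.
Proof using u_ge0.
apply: weighted_esum_le => [|j|j|j]; rewrite ?contrast_ge0 ?l1norm_ge0//.
set f := (fun c => freq R _ _ - _).
rewrite (eq_l1norm f (fun c => contrast (tau n) n t * (pX j c - pY j c) +
  (f c - contrast (tau n) n t * (pX j c - pY j c)))); last by move=> c; ring.
apply: le_trans (l1normD _ _) _; apply: leeD => //.
by apply: le_trans (l1normZ _ _) _; rewrite ger0_norm ?contrast_ge0.
Qed.

Lemma law_dist_le n : (tau n < n)%N -> (law_dist pX pY <=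
  coded_dist (take (tau n) (z n)) (drop (tau n) (z n)) + split_error n (tau n))%E.
Proof using u_ge0.
move=> taun; rewrite -[X in (X + _)%E]mul1e.
apply: weighted_esum_le => [//|j|j|j]; rewrite ?l1norm_ge0// mul1e.
set f := (fun c => freq R _ _ - _).
rewrite (eq_l1norm _ (fun c => f c - (f c -
  contrast (tau n) n (tau n) * (pX j c - pY j c)))); last first.
  by move=> c; rewrite contrast_eq1//; ring.
by apply: le_trans (l1normD _ _) _; rewrite l1normN.
Qed.

Lemma split_freq_cell n t j c : (t <= n)%N ->
  freq R (take t (z n)) (cell (q j) c) - freq R (drop t (z n)) (cell (q j) c) =
  block_freq (block (q j)) (symbols (q j) (splice x y (tau n))) t c -
  block_freq (block (q j))
    (fun i => symbols (q j) (splice x y (tau n)) (t + i)%N) (n - t) c.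
Proof.
by move=> tn; rewrite take_mkseq// drop_mkseq !freq_cell symbols_shift.
Qed.

Lemma l1norm_split_error_le4 n t j : (t <= n)%N -> (l1norm (fun c =>
     (freq R (take t (z n)) (cell (q j) c) - freq R (drop t (z n)) (cell (q j) c)
      - contrast (tau n) n t * (pX j c - pY j c))%R) <= 4%:E)%E.
Proof using pX1 pY1.
move=> tn; rewrite (eq_l1norm _ (fun c =>
  (block_freq (block (q j)) (symbols (q j) (splice x y (tau n))) t c -
  block_freq (block (q j))
    (fun i => symbols (q j) (splice x y (tau n)) (t + i)%N) (n - t) c) -
  contrast (tau n) n t * (pX j c - pY j c))); last first.
  by move=> c; rewrite split_freq_cell.
have pX1' : (l1norm (pX j) <= 1%:E)%E by rewrite pX1.
have pY1' : (l1norm (pY j) <= 1%:E)%E by rewrite pY1.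
apply: le_trans (l1normB_le _ _ _ _
  (l1normB_le _ _ _ _ (l1norm_block_freq _ _ _ _ _) (l1norm_block_freq _ _ _ _ _))
  (l1normZ_le _ _ _ (l1normB_le _ _ _ _ pX1' pY1'))) _.
rewrite lee_fin ger0_norm ?contrast_ge0//.
by have := @contrast_le1 R (tau n) n t; lra.
Qed.

(** The law of large numbers is applied with a slope [m * e / 12] small enough
    for its error to be half of the bound [e]; the constants are absorbed by [n]. *)
Lemma l1norm_split_error_cvg0 (m : R) (t : nat -> nat) : 0 < m ->
    (forall n, (t n <= n)%N) ->
    (\forall n \near \oo, m * n%:R <= (t n)%:R /\ m * n%:R <= (n - t n)%:R) ->
  forall j (e : R), 0 < e -> \forall n \near \oo, (l1norm (fun c =>
     (freq R (take (t n) (z n)) (cell (q j) c)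
      - freq R (drop (t n) (z n)) (cell (q j) c)
      - contrast (tau n) n (t n) * (pX j c - pY j c))%R) <= e%:E)%E.
Proof using pX_ge0 pY_ge0 pX1 pY1 X_lln Y_lln tau_le.
move=> m0 tn mt j e e0; pose e' := m * e / 12.
have e'0 : 0 < e' by rewrite divr_gt0// mulr_gt0.
have [KX KX0 EX] := l1norm_occ_linear _ _ (pX_ge0 j) (pX1 j) (X_lln j) _ e'0.
have [KY KY0 EY] := l1norm_occ_linear _ _ (pY_ge0 j) (pY1 j) (Y_lln j) _ e'0.
pose K := KX + KY; have K0 : 0 <= K by rewrite addr_ge0.
near=> n.
have n0 : (0 : R) < n%:R by rewrite ltr0n; near: n; exact: nbhs_infty_gt.
have [mtn mntn] : m * n%:R <= (t n)%:R /\ m * n%:R <= (n - t n)%:R by near: n.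
rewrite (eq_l1norm _ (fun c =>
  block_freq (block (q j)) (symbols (q j) (splice x y (tau n))) (t n) c -
  block_freq (block (q j))
    (fun i => symbols (q j) (splice x y (tau n)) (t n + i)%N) (n - t n) c -
  contrast (tau n) n (t n) * (pX j c - pY j c))); last first.
  by move=> c; rewrite split_freq_cell.
have szX i := symbols_splice_left (q j) x y (tau n) i.
have szY i := symbols_splice_right (q j) x y (tau n) i.
apply: le_trans (split_block_freq _ _ _ _ _ _ _ szX szY e' K (m * n%:R) _ _
  (block_gt0 (q j)) (ltW e'0) K0 (tau_le n) (mulr_gt0 m0 n0) mtn (tn n) mntn _ _) _.
- by move=> i; apply: le_trans (EX i) _; rewrite lee_fin lerD2l lerDl.
- by move=> i; apply: le_trans (EY i) _; rewrite lee_fin lerD2l lerDr.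
have big : 2 * (10 * (block (q j))%:R + 6 * K) / (m * e) <= n%:R.
  by near: n; exact: nbhs_infty_ger.
move: big; rewrite ler_pdivrMr ?mulr_gt0// lee_fin ler_pdivrMr ?mulr_gt0//.
have -> : 6 * (e' * n%:R + K) = n%:R * (m * e) / 2 + 6 * K by rewrite /e'; field.
have -> : e * (m * n%:R) = n%:R * (m * e) by ring.
by lra.
Unshelve. all: end_near. Qed.

Lemma split_error_cvg0 (m : R) (t : nat -> nat) : 0 < m ->
    (forall n, (t n <= n)%N) ->
    (\forall n \near \oo, m * n%:R <= (t n)%:R /\ m * n%:R <= (n - t n)%:R) ->
  forall e : R, 0 < e -> \forall n \near \oo, (split_error n (t n) <= e%:E)%E.
Proof using u_ge0 u_summable pX_ge0 pY_ge0 pX1 pY1 X_lln Y_lln tau_le.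
move=> m0 tn mt; apply: (@esum_dominated_cvg0 _ _ _ (fun j => 4%:E * (u j)%:E)%E).
- by move=> n j; rewrite mule_ge0 ?lee_fin ?l1norm_ge0.
- by move=> n j; rewrite muleC lee_wpmul2r ?lee_fin ?l1norm_split_error_le4.
- apply: le_lt_trans (esumZ_le _ _ _ _ _ _ _) _ => //.
  by apply: lte_mul_pinfty; rewrite ?lee_fin.
move=> j e e0.
(* The weight [u j] may vanish, hence the division by [u j + 1]. *)
have u1 : 0 < u j + 1 by rewrite ltr_wpDl.
have := l1norm_split_error_cvg0 _ _ m0 tn mt j _ (divr_gt0 e0 u1).
apply: filterS => n /(lee_wpmul2l (x := (u j)%:E)) h; apply: le_trans (h _) _.
  by rewrite lee_fin.
rewrite -EFinM lee_fin mulrCA ler_piMr ?(ltW e0)//.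
by rewrite ler_pdivrMr// mul1r lerDl.
Qed.

(** With [d] the empirical distance of a split and [D] that of the laws,
    [D <= d tau + o(1) <= d t + o(1) <= contrast * D + o(1)], and [1 - contrast]
    bounds [|t - tau| / n]. *)
Lemma split_near_change (m : R) (t : nat -> nat) : 0 < m ->
    (forall n, (t n <= n)%N) ->
    (\forall n \near \oo, m * n%:R <= (t n)%:R /\ m * n%:R <= (n - t n)%:R) ->
    (\forall n \near \oo, m * n%:R <= (tau n)%:R /\ m * n%:R <= (n - tau n)%:R) ->
    (\forall n \near \oo, coded_dist (take (tau n) (z n)) (drop (tau n) (z n)) <=
       coded_dist (take (t n) (z n)) (drop (t n) (z n)))%E ->
    (0 < law_dist pX pY)%E ->
  forall e : R, 0 < e -> \forall n \near \oo, `|(t n)%:R - (tau n)%:R| / n%:R <= e.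
Proof using u_ge0 u_summable pX_ge0 pY_ge0 pX1 pY1 X_lln Y_lln tau_le.
move=> m0 tn mt mtau best D0 e e0.
have Dfin : law_dist pX pY \is a fin_num.
  rewrite ge0_fin_numE ?(ltW D0)//.
  apply: (@le_lt_trans _ _ (\esum_(j in [set: J]) (2%:E * (u j)%:E))%E).
    apply: le_esum => j _; rewrite muleC lee_wpmul2r ?lee_fin//.
    have pX1' : (l1norm (pX j) <= 1%:E)%E by rewrite pX1.
    have pY1' : (l1norm (pY j) <= 1%:E)%E by rewrite pY1.
    by apply: le_trans (l1normB_le _ _ _ _ pX1' pY1') _; rewrite lee_fin.
  apply: le_lt_trans (esumZ_le _ _ _ _ _ _ _) _ => //.
  by apply: lte_mul_pinfty; rewrite ?lee_fin.
pose D := fine (law_dist pX pY).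
have DE : law_dist pX pY = D%:E by rewrite fineK.
have {}D0 : 0 < D by rewrite -lte_fin -DE.
have eD : 0 < e * D / 2 by rewrite divr_gt0// mulr_gt0.
have errt := split_error_cvg0 _ _ m0 tn mt _ eD.
have errtau := split_error_cvg0 _ _ m0 tau_le mtau _ eD.
near=> n.
have n0 : (0 < n)%N by near: n; exact: nbhs_infty_gt.
have taun : (tau n < n)%N.
  have [_] : m * n%:R <= (tau n)%:R /\ m * n%:R <= (n - tau n)%:R by near: n.
  rewrite -subn_gt0 -(ltr0n R); apply: lt_le_trans.
  by rewrite mulr_gt0// ltr0n.
apply: le_trans (dist_le_contrast _ _ _ n0 (tau_le n) (tn n)) _.
set g := contrast _ _ _.
have : (D%:E <= (g * D + e * D / 2 + e * D / 2)%:E)%E.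
  rewrite -DE; apply: le_trans (law_dist_le _ taun) _.
  rewrite EFinD; apply: leeD; last by near: n.
  apply: (@le_trans _ _ (coded_dist (take (t n) (z n)) (drop (t n) (z n)))).
    by near: n.
  apply: le_trans (coded_dist_le _ _) _.
  by rewrite DE -EFinM EFinD; apply: leeD => //; near: n.
rewrite lee_fin => gD.
rewrite -(ler_pM2r D0); lra.
Unshelve. all: end_near. Qed.

End coded_distance.
(** * The product topology and its Borel sets *)

Lemma cvg_ptws (I : eqType) (A : topologicalType) (F : set_system {ptws I -> A})
    (x : {ptws I -> A}) : Filter F ->
  (forall i, (fun y : {ptws I -> A} => y i) @ F --> x i) -> F --> x.
Proof.
move=> FF Fx; apply/cvg_sup => i B [_ [[C oC <-] Cx] CB].
apply: filterS CB _; apply: (Fx i); exact: open_nbhs_nbhs.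
Qed.

Lemma ptws_eval_continuous (I : eqType) (A : topologicalType) (i : I) :
  continuous (fun x : {ptws I -> A} => x i).
Proof. exact: (@proj_continuous I (fun=> A) i). Qed.

Section ptws_borel.
Context {A : ptopologicalType} {I : eqType}.
Local Notation T := {ptws I -> A}.

Lemma open_measurable_borel (U : set (borel T)) : @open T U -> measurable U.
Proof. exact: sub_sigma_algebra. Qed.

Lemma closed_measurable_borel (U : set (borel T)) : @closed T U -> measurable U.
Proof.
move=> cU; rewrite -(setCK U); apply: measurableC.
by apply: open_measurable_borel; exact: closed_openC.
Qed.

End ptws_borel.

Lemma continuous_measurable_borel (A : ptopologicalType) (I K : eqType)
    (f : {ptws K -> A} -> {ptws I -> A}) : continuous f ->
  measurable_fun [set: borel {ptws K -> A}]
    (f : borel {ptws K -> A} -> borel {ptws I -> A}).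
Proof.
move=> /continuousP cf.
apply: (measurability (@open {ptws I -> A} : set (set (borel {ptws I -> A})))) => //.
move=> _ [U oU <-].
by rewrite setTI; apply: open_measurable_borel; exact: cf.
Qed.

Lemma measure_fibers d (T : measurableType d) (R : realType)
    (mu : {measure set T -> \bar R}) (S : choiceType) (f : T -> S) (D : set S) :
    countable D -> (forall c, D c -> measurable (f @^-1` [set c])) ->
  mu (f @^-1` D) = (\esum_(c in D) mu (f @^-1` [set c]))%E.
Proof.
elim/choicePpointed: S => S in f D *.
  by move=> _ _; rewrite (empty_eq0 D) preimage_set0 measure0 esum_set0.
move=> cD mf.
have [B /card_esym/card_set_bijP[g gbij]] : exists B : set nat, (D #= B)%card.
  by have /countable_bijP := cD.
have [gD ginj gsurj] := gbij.
rewrite (reindex_esum B D g)//.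
rewrite -[B in RHS]set_mem_set -nneseries_esum; last by [].
rewrite -measure_bigcup; last 2 first.
- by move=> i Bi; apply: mf; apply: gD.
- apply/trivIsetP => i j Bi Bj /eqP ij; apply/seteqP; split => // x [/= fi fj].
  apply: ij; apply: ginj; [exact: mem_set|exact: mem_set|].
  by rewrite -fi -fj.
congr (mu _); apply/seteqP; split => [x /= Dfx|x [i Bi /= ->]]; last exact: gD.
by have [i Bi gi] := gsurj _ Dfx; exists i.
Qed.

(** Every open set is the increasing union of the unions of fibers it contains,
    so two laws that agree on all the fibers agree on the open sets, which
    generate the Borel sets and are stable under intersection. *)
Lemma fibers_determine_measure (I : eqType) (A : ptopologicalType) (R : realType)
    (mu1 mu2 : probability (borel {ptws I -> A}) R)
    (S : nat -> choiceType) (f : forall n, {ptws I -> A} -> S n) :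
    (forall n, countable [set: S n]) ->
    (forall n c, measurable (f n @^-1` [set c] : set (borel {ptws I -> A}))) ->
    (forall n x y, f n.+1 x = f n.+1 y -> f n x = f n y) ->
    (forall (U : set {ptws I -> A}) x, open U -> U x ->
       exists n, forall y, f n y = f n x -> U y) ->
    (forall n c, mu1 (f n @^-1` [set c]) = mu2 (f n @^-1` [set c])) ->
  forall B, measurable B -> mu1 B = mu2 B.
Proof.
move=> cS mf refine sep mu12.
have mfD n (D : set (S n)) : measurable (f n @^-1` D : set (borel {ptws I -> A})).
  have -> : f n @^-1` D = \bigcup_(c in D) (f n @^-1` [set c]).
    by apply/seteqP; split => [x Dx|x [c Dc /= ->]//]; exists (f n x).
  rewrite bigcup_mkcond; apply: countable_bigcupT_measurable => // c.
  by case: ifP.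
have mu12D n (D : set (S n)) : mu1 (f n @^-1` D) = mu2 (f n @^-1` D).
  have cD : countable D by apply: sub_countable (cS n); exact: subset_card_le.
  rewrite !measure_fibers//; apply: eq_esum => c _; exact: mu12.
have open12 (U : set {ptws I -> A}) : open U -> mu1 U = mu2 U.
  move=> oU.
  pose D n := [set c | (f n @^-1` [set c] `<=` U)].
  have -> : U = \bigcup_n (f n @^-1` D n).
    apply/seteqP; split => [x Ux|x [n _ /= Dx]]; last exact: Dx.
    by have [n fU] := sep U x oU Ux; exists n.
  have nd : nondecreasing_seq (fun n => f n @^-1` D n).
    apply/nondecreasing_seqP => n; apply/subsetPset => x /= Dx y /= /refine fxy.
    exact: Dx.
  have mD n := mfD n (D n).
  have mU : measurable (\bigcup_n (f n @^-1` D n) : set (borel {ptws I -> A})).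
    exact: bigcup_measurable.
  have c1 := @nondecreasing_cvg_mu _ _ _ mu1 _ mD mU nd.
  have c2 := @nondecreasing_cvg_mu _ _ _ mu2 _ mD mU nd.
  have mu12F : mu1 \o (fun n => f n @^-1` D n) = mu2 \o (fun n => f n @^-1` D n).
    by apply/funext => n /=; exact: mu12D.
  by move: c1; rewrite mu12F => c1; exact: (cvg_unique _ c1 c2).
move=> B mB; apply: (@measure_unique _ R (borel {ptws I -> A}) (@open {ptws I -> A}) (fun=> setT) _ _ _ _ mu1 mu2) => //.
- by move=> *; exact: openI.
- by move=> _; exact: openT.
- by rewrite bigcup_const.
- by move=> _; apply: (@le_lt_trans _ _ 1%E); [exact: probability_le1|exact: ltry].
Qed.

Lemma ae_sub d (T : measurableType d) (R : realType)
    (mu : {measure set T -> \bar R}) (P Q : T -> Prop) :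
  (forall x, P x -> Q x) -> {ae mu, forall x, P x} -> {ae mu, forall x, Q x}.
Proof. exact: filterS. Qed.

Lemma ae_forall_countable d (T : measurableType d) (R : realType)
    (mu : {measure set T -> \bar R}) (I : choiceType) (Q : I -> T -> Prop) :
    countable [set: I] -> (forall i, {ae mu, forall x, Q i x}) ->
  {ae mu, forall x i, Q i x}.
Proof.
move=> /countable_injP[g ginj] aeQ.
have : {ae mu, forall x n, forall i, g i = n -> Q i x}.
  apply: ae_foralln => n.
  have [[i gi]|ni] := pselect (exists i, g i = n).
    apply: filterS (aeQ i) => x Qx j gj.
    have -> // : j = i by apply: ginj; rewrite ?gi ?gj ?mem_setT.
  by apply: aeW => x i gi; exfalso; apply: ni; exists i.
by apply: filterS => x Qx i; exact: (Qx (g i)).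
Qed.
(** * Laws of large numbers for stationary ergodic processes *)

Section ergodic_coding.
Context {A : ptopologicalType} {R : realType}.
Implicit Types (rho : probability (borel (trajectory A)) R) (Q : coding A).

Definition symbol_event Q i c : set (borel (trajectory A)) :=
  (fun x => symbols Q x i) @^-1` [set c].

Definition law rho Q (c : symbol Q) : R := fine (rho (symbol_event Q 0 c)).

Lemma measurable_symbol_event Q i c : measurable (symbol_event Q i c).
Proof.
have cw : continuous (fun x : trajectory A => @window A x i (block Q) : word A (block Q)).
  move=> x; apply: cvg_ptws => j; exact: (@ptws_eval_continuous nat A (i + j)%N x).
have mw := continuous_measurable_borel _ _ _ _ cw.
by have := mw measurableT _ (measurable_encode Q c); rewrite setTI.
Qed.

Lemma law_ge0 rho Q c : 0 <= law rho Q c.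
Proof. by rewrite fine_ge0. Qed.

Lemma EFin_law rho Q c : (law rho Q c)%:E = rho (symbol_event Q 0 c).
Proof.
rewrite fineK// fin_num_measure//; exact: measurable_symbol_event.
Qed.

(** The countably many symbols partition the trajectories. *)
Lemma l1norm_law rho Q : (l1norm (law rho Q) = 1)%E.
Proof.
have -> : (1 = rho ((fun x => symbols Q x 0) @^-1` [set: symbol Q]))%E.
  by rewrite preimage_setT probability_setT.
rewrite measure_fibers; last 2 first.
- exact: symbol_countable.
- by move=> c _; exact: measurable_symbol_event.
by apply: eq_esum => c _; rewrite ger0_norm ?law_ge0// EFin_law.
Qed.

Lemma stationary_symbol_event rho Q i c : stationary rho ->
  rho (symbol_event Q i c) = rho (symbol_event Q 0 c).
Proof.
move=> /(_ i (block Q) (cell Q c) (block_gt0 Q) (measurable_encode Q c)) h.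
exact/esym.
Qed.

Lemma block_freq_indic Q n c (x : borel (trajectory A)) : (block Q <= n)%N ->
  block_freq (block Q) (symbols Q x) n c =
  (n - block Q).+1%:R^-1 *
    \sum_(i < (n - block Q).+1) \1_(symbol_event Q i c) x :> R.
Proof.
move=> kn; rewrite /block_freq kn; congr (_ * _); apply: eq_bigr => i _.
rewrite indicE; congr (_%:R); congr nat_of_bool.
by apply/eqP/idP => [xc|/set_mem//]; apply/mem_set.
Qed.

Lemma measurable_block_freq Q n c :
  measurable_fun setT (fun x : borel (trajectory A) =>
    block_freq (block Q) (symbols Q x) n c : R).
Proof.
have [kn|nk] := leqP (block Q) n; last first.
  rewrite (_ : (fun _ => _) = cst 0)//; apply/funext => x /=.
  by rewrite /block_freq leqNgt nk.
rewrite (_ : (fun _ => _) = (fun x => (n - block Q).+1%:R^-1 *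
    \sum_(i < (n - block Q).+1) \1_(symbol_event Q i c) x)); last first.
  by apply/funext => x; rewrite block_freq_indic.
apply: (measurableT_comp (mulrl_measurable _)).
apply: measurable_sum => i.
by apply: measurable_indic; exact: measurable_symbol_event.
Qed.

Lemma block_freq_ge0 (T : choiceType) k (s : nat -> T) n c : 0 <= block_freq k s n c :> R.
Proof. by rewrite /block_freq; case: ifP => _ //; rewrite mulr_ge0// ?occ_ge0. Qed.

Lemma block_freq_le1 (T : choiceType) k (s : nat -> T) n c : block_freq k s n c <= 1 :> R.
Proof.
rewrite /block_freq; case: ifP => _ //; rewrite mulrC ler_pdivrMr// mul1r.
rewrite /occ -[leRHS]mulr1 mulr_natl -[X in _ <= _ *+ X]card_ord -sumr_const.
by apply: ler_sum => i _; rewrite lern1 leq_b1.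
Qed.

(** By stationarity all windows have the same law. *)
Lemma expectation_block_freq rho Q n c : stationary rho -> (block Q <= n)%N ->
  (\int[rho]_x (block_freq (block Q) (symbols Q x) n c)%:E = (law rho Q c)%:E)%E.
Proof.
move=> st kn; under eq_integral do rewrite (block_freq_indic _ _ _ _ kn) EFinM -sumEFin.
have mS i := measurable_symbol_event Q i c.
rewrite ge0_integralZl//; last 2 first.
- apply: emeasurable_sum => i; apply/measurable_EFinP; exact: measurable_indic.
- by move=> x _; apply: sume_ge0 => i _; rewrite lee_fin.
rewrite ge0_integral_sum//; last first.
  by move=> i; apply/measurable_EFinP; exact: measurable_indic.
rewrite (eq_bigr (fun=> (law rho Q c)%:E)); last first.
  move=> i _; rewrite integral_indic// setIT EFin_law.
  exact: stationary_symbol_event.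
rewrite sumEFin -EFinM sumr_const card_ord -(mulr_natl (law rho Q c)) mulrA mulVf ?mul1r//.
Qed.

(** The almost sure constant limit is identified by taking expectations. *)
Lemma block_freq_lln rho Q c : stationary_ergodic rho ->
  {ae rho, forall x, block_freq (block Q) (symbols Q x) n c @[n --> \oo] --> law rho Q c}.
Proof.
move=> [st /(_ _ _ (block_gt0 Q) (measurable_encode Q c))[l aex]].
pose f n (x : borel (trajectory A)) := block_freq (block Q) (symbols Q x) n c : R.
have {}aex : {ae rho, forall x, f n x @[n --> \oo] --> l}.
  apply: ae_sub aex => x; apply: cvg_trans; apply: near_eq_cvg.
  by apply: nearW => n; rewrite -[encode Q @^-1` _]/(cell Q c) freq_cell.
suff <- : l = law rho Q c by [].
have [] := @dominated_convergence _ _ _ rho setT measurableT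
  (fun n x => (f n x)%:E) (cst l%:E) (cst 1%:E).
- by move=> n; apply/measurable_EFinP; exact: measurable_block_freq.
- exact: measurable_cst.
- by apply: ae_sub aex => x fx _; apply: cvg_EFin fx; apply: nearW.
- by apply: finite_measure_integrable_cst.
- apply: aeW => x n _.
  by rewrite lee_fin ger0_norm ?block_freq_ge0 ?block_freq_le1.
move=> _ _ flim.
have int_l : (\int[rho]_x (cst l%:E) x = l%:E)%E.
  by rewrite integral_cst// -[RHS]mule1; congr (_ * _)%E; exact: probability_setT.
rewrite int_l in flim.
have fE : (\int[rho]_x (f n x)%:E)%E @[n --> \oo] --> (law rho Q c)%:E.
  apply: cvg_near_cst; near=> n; apply: expectation_block_freq => //.
  by near: n; exact: nbhs_infty_ge.
have lE : l%:E = (law rho Q c)%:E by exact: (cvg_unique _ flim fE).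
exact: EFin_inj lE.
Unshelve. all: end_near. Qed.

Lemma symbols_lln rho Q c : stationary_ergodic rho ->
  {ae rho, forall x, n%:R^-1 * occ (symbols Q x) n c @[n --> \oo] --> law rho Q c}.
Proof.
move=> se; apply: ae_sub (block_freq_lln rho Q c se) => x.
(* A sample of [n + block Q - 1] letters has exactly [n] windows. *)
rewrite -(cvg_shiftn (block Q).-1); apply: cvg_trans; apply: near_eq_cvg.
apply: nearW => -[|n] /=; rewrite /block_freq.
  by rewrite ifF ?occ0 ?mulr0//; have := block_gt0 Q; lia.
have kn := block_gt0 Q; rewrite ifT; last by lia.
by rewrite (_ : (_ - _).+1 = n.+1)//; lia.
Qed.

Lemma generated_ae d (T : measurableType d) (P : probability T R)
    (X : {mfun T >-> borel (trajectory A)}) rho (E : trajectory A -> Prop) :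
  generated_by P X rho -> {ae rho, forall x, E x} -> {ae P, forall w, E (X w)}.
Proof.
move=> gX [N [mN N0 PN]]; exists (X @^-1` N); split.
- by rewrite -[_ @^-1` _]setTI; exact: measurable_funPT.
- by have := gX _ mN; rewrite N0.
- by move=> w nP; apply: PN.
Qed.

End ergodic_coding.

(** * Consistency for a separating family of codings *)

Section consistency.
Context {R : realType} {A : ptopologicalType} {J : choiceType}.
Variables (q : J -> coding A) (u : J -> R).
Hypotheses (J_countable : countable [set: J]) (u_gt0 : forall j, 0 < u j).
Hypothesis u_summable : (\esum_(j in [set: J]) (u j)%:E < +oo)%E.
Hypothesis separating : forall mu1 mu2 : probability (borel (trajectory A)) R,
  (forall j c, mu1 (symbol_event (q j) 0 c) = mu2 (symbol_event (q j) 0 c)) ->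
  same_process mu1 mu2.

(** If the distance vanished, all cells would have the same probability under both
    laws, and a separating family determines the process. *)
Lemma law_dist_gt0 mu1 mu2 : ~ same_process mu1 mu2 ->
  (0 < law_dist q u (fun j => law mu1 (q j)) (fun j => law mu2 (q j)))%E.
Proof using u_gt0 separating.
move=> mu12; rewrite ltNge; apply/negP => D0; apply: mu12; apply: separating => j c.
rewrite -!EFin_law; congr EFin; apply/eqP; rewrite -subr_eq0; apply/eqP.
apply: (@l1norm_le_eq0 _ _ (fun c => law mu1 (q j) c - law mu2 (q j) c)).
rewrite -(@pmule_rle0 _ (u j)%:E) ?lte_fin//; apply: le_trans D0.
exact: (le_esum_term _ _ (fun j => (u j)%:E * l1norm (fun c => law mu1 (q j) c - law mu2 (q j) c)%R)%E).
Qed.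

(** A maximiser is at least as good as the change point, which is admissible by
    hypothesis, hence is close to it; and [tau / n] is within [1 / n] of [theta]. *)
Lemma argmax_consistent (theta alpha beta : R) rhoX rhoY
    d (T : measurableType d) (P : probability T R)
    (X Y : {mfun T >-> borel (trajectory A)}) (t : seq A -> nat) :
    0 < theta < 1 -> 0 < alpha -> beta < 1 ->
    (\forall n \near \oo,
       alpha * n%:R < (change_index theta n)%:R < beta * n%:R) ->
    stationary_ergodic rhoX -> stationary_ergodic rhoY ->
    ~ same_process rhoX rhoY ->
    generated_by P X rhoX -> generated_by P Y rhoY ->
    (forall z, (exists s : nat, alpha * (size z)%:R <= s%:R <= beta * (size z)%:R) ->
       alpha * (size z)%:R <= (t z)%:R <= beta * (size z)%:R /\
       forall s : nat, alpha * (size z)%:R <= s%:R <= beta * (size z)%:R ->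
         (coded_dist q u (take s z) (drop s z) <=
          coded_dist q u (take (t z) z) (drop (t z) z))%E) ->
  let Z w n := mkseq (X w) (change_index theta n) ++
               mkseq (Y w) (n - change_index theta n) in
  {ae P, forall w,
    `|(t (Z w n))%:R / (size (Z w n))%:R - theta| @[n --> \oo] --> (0 : R)}.
Proof using J_countable u_gt0 u_summable separating.
move=> /andP[th0 th1] al0 be1 inrange seX seY XY gX gY tP Z.
have lln rho (W : {mfun T >-> borel (trajectory A)}) : stationary_ergodic rho ->
    generated_by P W rho -> {ae P, forall w, forall j c,
      n%:R^-1 * occ (symbols (q j) (W w)) n c @[n --> \oo] --> law rho (q j) c}.
  move=> se gW; apply: ae_forall_countable => // j.
  apply: ae_forall_countable => [|c]; first exact: symbol_countable.
  exact: (generated_ae _ _ _ W _ (fun x => n%:R^-1 * occ (symbols (q j) x) n c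
    @[n --> \oo] --> law rho (q j) c) gW (symbols_lln rho (q j) c se)).
apply: filterS2 (lln _ X seX gX) (lln _ Y seY gY) => w Xlln Ylln.
pose tau n := change_index theta n.
have tau_itv n : (tau n)%:R <= n%:R * theta < (tau n).+1%:R.
  by apply: truncn_itv; rewrite mulr_ge0// ltW.
have tau_le n : (tau n <= n)%N.
  rewrite -(ler_nat R); have /andP[/le_trans->//] := tau_itv n.
  by rewrite ler_piMr// ltW.
have ZE n : Z w n = mkseq (splice (X w) (Y w) (tau n)) n by exact: mkseq_splice.
have sizeZ n : size (Z w n) = n by rewrite ZE size_mkseq.
(* Truncated so as to be a split of the sample for every [n], including the small
   ones where no integer is admissible. *)
pose t' n := minn (t (Z w n)) n.
have t'_le n : (t' n <= n)%N by exact: geq_minr.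
pose m := Num.min alpha (1 - beta).
have m0 : 0 < m by rewrite lt_min al0 subr_gt0.
have far n s : (s <= n)%N -> alpha * n%:R <= s%:R <= beta * n%:R ->
    m * n%:R <= s%:R /\ m * n%:R <= (n - s)%:R.
  move=> sn /andP[als sbe]; split.
    by apply: le_trans als; rewrite ler_wpM2r// ge_min lexx.
  apply: (@le_trans _ _ ((1 - beta) * n%:R)).
    by rewrite ler_wpM2r// ge_min lexx orbT.
  by rewrite natrB// mulrBl mul1r lerD2l lerN2.
have tau_adm : \forall n \near \oo, alpha * n%:R <= (tau n)%:R <= beta * n%:R.
  by apply: filterS inrange => n /andP[/ltW-> /ltW->].
have t_adm : \forall n \near \oo, t' n = t (Z w n) /\
    alpha * n%:R <= (t' n)%:R <= beta * n%:R.
  apply: filterS tau_adm => n adm.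
  have [] := tP (Z w n); rewrite sizeZ; first by exists (tau n).
  move=> tadm _; suff -> : t' n = t (Z w n) by [].
  apply/minn_idPl; rewrite -(ler_nat R); have /andP[_ /le_trans->//] := tadm.
  by rewrite ler_piMl// ltW.
have close : forall e : R, 0 < e ->
    \forall n \near \oo, `|(t' n)%:R - (tau n)%:R| / n%:R <= e.
  apply: (split_near_change q u (fun j => ltW (u_gt0 j)) u_summable (X w) (Y w)
    (fun j => law rhoX (q j)) (fun j => law rhoY (q j)) _ _ _ _ Xlln Ylln tau tau_le
    m t' m0 t'_le) => [j c|j c|j|j||||].
  - exact: law_ge0.
  - exact: law_ge0.
  - exact: l1norm_law.
  - exact: l1norm_law.
  - by apply: filterS t_adm => n [_]; exact: far.
  - by apply: filterS tau_adm => n; exact: far.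
  - apply: filterS2 t_adm tau_adm => n [t't _] adm.
    have [] := tP (Z w n); rewrite sizeZ; first by exists (tau n).
    by move=> _ /(_ _ adm); rewrite t't ZE.
  - exact: law_dist_gt0.
apply/cvgrPdist_le => e e0.
have e20 : 0 < e / 2 by rewrite divr_gt0.
near=> n.
have n0 : (0 : R) < n%:R by rewrite ltr0n; near: n; exact: nbhs_infty_gt.
have nbig : 2 / e <= n%:R by near: n; exact: nbhs_infty_ger.
have [t't _] : t' n = t (Z w n) /\ alpha * n%:R <= (t' n)%:R <= beta * n%:R.
  by near: n.
have tn : `|(t' n)%:R - (tau n)%:R| / n%:R <= e / 2 by near: n; exact: close.
rewrite sub0r normrN normr_id sizeZ -t't.
have -> : (t' n)%:R / n%:R - theta =
    ((t' n)%:R - (tau n)%:R) / n%:R + ((tau n)%:R - n%:R * theta) / n%:R.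
  by field; rewrite gt_eqF.
apply: le_trans (ler_normD _ _) _; rewrite (splitr e); apply: lerD.
  by rewrite normrM normfV (ger0_norm (ltW n0)).
rewrite normrM normfV (ger0_norm (ltW n0)) ler_pdivrMr//.
apply: (@le_trans _ _ 1).
  by have := tau_itv n; rewrite -natr1 ler_norml => /andP[? ?]; lra.
by move: nbig; rewrite ler_pdivrMr// => nbig; lra.
Unshelve. all: end_near. Qed.

End consistency.
(** * Weights and cylinders *)

Section weights.
Context {R : realType}.

Lemma weight_gt0 k : 0 < weight k.+1 :> R.
Proof. by rewrite /weight invr_gt0 ltr0n muln_gt0. Qed.

(** The weights telescope: [1 / (k (k + 1)) = 1 / k - 1 / (k + 1)]. *)
Lemma weight_summable : (\esum_(k in [set: nat]) (weight k.+1 : R)%:E <= 1)%E.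
Proof.
have w0 k : (0 <= (weight k.+1 : R)%:E)%E by rewrite lee_fin ltW ?weight_gt0.
rewrite -nneseries_esumT//; apply: lime_le.
  by apply: is_cvg_nneseries => *; exact: w0.
apply: nearW => n; rewrite sumEFin lee_fin.
suff -> : \sum_(0 <= k < n) (weight k.+1 : R) = 1 - n.+1%:R^-1.
  by rewrite gerBl invr_ge0.
elim: n => [|n IHn]; first by rewrite big_nil invr1 subrr.
rewrite big_nat_recr//= IHn /weight natrM -[n.+2%:R]natr1.
have n0 : n.+1%:R != 0 :> R by rewrite pnatr_eq0.
have n1 : n.+1%:R + 1 != 0 :> R by rewrite natr1 pnatr_eq0.
by field; rewrite nat1r n1 n0.
Qed.

Lemma weight_prod_summable :
  (\esum_(j in [set: nat * nat]) (weight j.1.+1 * weight j.2.+1 : R)%:E < +oo)%E.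
Proof.
have -> : [set: nat * nat] = setT `*`` (fun=> setT) by apply/seteqP.
rewrite -(@esum_esum _ _ _ setT (fun=> setT) (fun i j => (weight i.+1 * weight j.+1 : R)%:E)); last first.
  by move=> i j _ _; rewrite lee_fin mulr_ge0// ltW// weight_gt0.
apply: (@le_lt_trans _ _ 1%E); last exact: ltry.
apply: le_trans weight_summable; apply: le_esum => i _.
under eq_esum do rewrite EFinM.
apply: le_trans (esumZ_le _ _ _ _ _ _ _) _.
- by rewrite ltW ?weight_gt0.
- by move=> j; rewrite lee_fin ltW ?weight_gt0.
rewrite -[leRHS]mule1; apply: lee_wpmul2l; last exact: weight_summable.
by rewrite lee_fin ltW ?weight_gt0.
Qed.

End weights.

Lemma measurable_coordinates (A : ptopologicalType) k (B : 'I_k -> set A) :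
    (forall i, open (B i) \/ closed (B i)) ->
  measurable ([set v | forall i, B i (v i)] : set (borel (word A k))).
Proof.
move=> ocB; pose proj i (v : word A k) := v i.
have cproj i : continuous (proj i) by exact: ptws_eval_continuous.
have -> : [set v | forall i, B i (v i)] = \bigcap_(i in [set: 'I_k]) (proj i @^-1` B i).
  by apply/seteqP; split => [v Bv i _|v Bv i]; [exact: Bv|exact: (Bv i)].
apply: fin_bigcap_measurable => // i _; case: (ocB i) => [oB|cB].
  by apply: open_measurable_borel; apply: open_comp => // v _; exact: cproj.
apply: closed_measurable_borel; apply: closed_comp => // v _; exact: cproj.
Qed.

(** Sequentially, [close n] shrinks to [x]: otherwise choosing a point of each
    [close n] outside [U] gives a sequence that converges to [x] and avoids [U]. *)
Lemma open_trajectory (A : ptopologicalType) (U : set (trajectory A)) (x : trajectory A)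
    (close : nat -> set (trajectory A)) :
    (forall y_ : nat -> trajectory A, (forall n, close n (y_ n)) ->
      forall i, y_ n i @[n --> \oo] --> x i) ->
  open U -> U x -> exists n, close n `<=` U.
Proof.
move=> cvgx oU Ux; apply: contrapT => nU.
have /choice[y yP] : forall n, exists y, close n y /\ ~ U y.
  move=> n; apply: contrapT => ny; apply: nU; exists n => y cy.
  by apply: contrapT => nUy; apply: ny; exists y.
have yx : y @ \oo --> x.
  by apply: cvg_ptws => i; exact: (cvgx y (fun n => (yP n).1) i).
have /yx[n _ /(_ n (leqnn n))] : nbhs x U by exact: open_nbhs_nbhs.
exact: (yP n).2.
Qed.

(** * Finite alphabets *)

Section finite_alphabet.
Context {R : realType} (F : pdiscreteTopologicalType) (finF : finite_set [set: F]).

Lemma finite_words k : finite_set [set: word F k].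
Proof using finF.
have [X FX] := finite_fsetP.1 finF.
have XF (x : F) : x \in X.
  by have : [set: F] x by []; rewrite FX.
pose g (f : {ffun 'I_k -> X}) : word F k := fun i => val (f i).
suff -> : [set: word F k] = range g by apply: finite_image; exact: finite_finset.
apply/seteqP; split => // v _; exists [ffun i => [` XF (v i)]%fset] => //.
by apply/funext => i; rewrite /g ffunE.
Qed.

Lemma measurable_word k (c : word F k) : measurable ([set c] : set (borel (word F k))).
Proof.
have -> : [set c] = [set v : word F k | forall i, [set c i] (v i)].
  by apply/seteqP; split => [v -> i//|v vc]; apply/funext => i; exact: vc.
by apply: (measurable_coordinates F k (fun i => [set c i])) => i; left; exact: discrete_open.
Qed.

Definition word_coding (k : nat) : coding F := {|
  block := k.+1; symbol := word F k.+1; encode := id;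
  block_gt0 := ltn0Sn k;
  symbol_countable := finite_set_countable (finite_words k.+1);
  measurable_encode := @measurable_word k.+1 |}.

Lemma dhat_finiteE (x y : seq F) :
  dhat_finite x y = coded_dist word_coding (fun k => weight k.+1 : R) x y.
Proof.
rewrite /dhat_finite /coded_dist.
pose f k := ((weight k : R)%:E *
  (\sum_(b \in [set: word F k]) `|freq R x [set b] - freq R y [set b]|)%:E)%E.
rewrite -[LHS]/(\sum_(1 <= k <oo) f k)%E.
have f0 k : (0 <= f k)%E.
  apply: mule_ge0; first by rewrite lee_fin invr_ge0.
  by rewrite -fsumEFin ?fsume_ge0//; exact: finite_words.
rewrite -nneseries_addn// nneseries_esumT//; apply: eq_esum => k _.
rewrite addn1 /f; congr (_ * _)%E; rewrite /l1norm esum_fset//; last exact: finite_words.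
by rewrite fsumEFin//; exact: finite_words.
Qed.

Lemma word_coding_separating (mu1 mu2 : probability (borel (trajectory F)) R) :
  (forall k c, mu1 (symbol_event (word_coding k) 0 c) =
               mu2 (symbol_event (word_coding k) 0 c)) ->
  same_process mu1 mu2.
Proof.
apply: fibers_determine_measure.
- by move=> k; exact: symbol_countable (word_coding k).
- by move=> k c; exact: measurable_symbol_event.
- move=> k x y /= xy; apply/funext => -[i ik].
  have ik' : (i < k.+2)%N by rewrite ltnS ltnW.
  exact: (congr1 (fun v : word F k.+2 => v (Ordinal ik')) xy).
move=> U x oU Ux; apply: (open_trajectory _ _ x _ _ oU Ux) => y yx i.
apply: cvg_near_cst; near=> n.
have ni : (i < n.+1)%N by near: n; exists i.
exact: (congr1 (fun v : word F n.+1 => v (Ordinal ni)) (yx n)).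
Unshelve. all: end_near. Qed.

End finite_alphabet.

(** * The real alphabet *)

Section real_alphabet.
Context {R : realType}.
Local Notation A := (@letter R RealAlphabet).

(** The index of the dyadic cube of side [2^-l] that contains a word. *)
Definition floors (m l : nat) (v : word A m) : 'I_m -> int :=
  fun i => Num.floor ((v i : R) * 2 ^+ l).

Lemma cubeE m l c : cube l c = floors m l @^-1` [set c].
Proof.
have l0 : (0 : R) < 2 ^+ l by rewrite exprn_gt0.
apply/seteqP; split => [v vc|v /= <- i].
  apply/funext => i; apply: floor_def; have := vc i.
  by rewrite ler_pdivrMr// ltr_pdivlMr.
by rewrite ler_pdivrMr// ltr_pdivlMr//; exact: floor_itv.
Qed.

Lemma measurable_floors m l c :
  measurable (floors m l @^-1` [set c] : set (borel (word A m))).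
Proof.
rewrite -cubeE.
pose lo i := [set x : A | (c i)%:~R / 2 ^+ l <= (x : R)].
pose hi i := [set x : A | (x : R) < (c i + 1)%:~R / 2 ^+ l].
have -> : cube l c = [set v | forall i, lo i (v i)] `&` [set v | forall i, hi i (v i)].
  apply/seteqP; split => [v vc|v [vlo vhi] i].
    by split => i; have /andP[] := vc i.
  by apply/andP; split; [exact: vlo|exact: vhi].
apply: measurableI; apply: measurable_coordinates => i; [right|left].
- exact: closed_ge.
- exact: open_lt.
Qed.

Lemma countable_int_words m : countable [set: 'I_m -> int].
Proof.
apply/countable_injP; exists (fun c => choice.pickle [ffun i => c i]) => c c' _ _.
move=> /(pcan_inj (@choice.pickleK _))/ffunP cc'; apply/funext => i.
by have := cc' i; rewrite !ffunE.
Qed.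

Definition floor_coding (j : nat * nat) : coding A := {|
  block := j.1.+1; symbol := 'I_j.1.+1 -> int; encode := @floors j.1.+1 j.2.+1;
  block_gt0 := ltn0Sn j.1;
  symbol_countable := countable_int_words j.1.+1;
  measurable_encode := @measurable_floors j.1.+1 j.2.+1 |}.

(** No cube is empty, so the cubes are in bijection with their indices. *)
Lemma floors_surj m l c : exists v, floors m l v = c.
Proof.
exists (fun i => (c i)%:~R / 2 ^+ l); apply/funext => i.
by rewrite /floors divfK ?intrKfloor// expf_neq0.
Qed.

Lemma dhat_realE (x y : seq R) :
  dhat_real x y = coded_dist floor_coding
    (fun j => weight j.1.+1 * weight j.2.+1 : R) (x : seq A) (y : seq A).
Proof.
have w0 k : 0 <= (weight k : R) by rewrite invr_ge0.
have cubes0 m l : (0 <= \esum_(B in @cubes R m l) `|freq R x B - freq R y B|%:E)%E.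
  by apply: esum_ge0 => B _; rewrite lee_fin.
have g0 m l : (0 <= (weight m * weight l : R)%:E *
    \esum_(B in @cubes R m l) `|freq R x B - freq R y B|%:E)%E.
  by apply: mule_ge0 => //; rewrite lee_fin mulr_ge0.
rewrite /dhat_real /coded_dist -nneseries_addn; last first.
  by move=> m; apply: nneseries_ge0 => l _ _; exact: g0.
rewrite nneseries_esumT; last by move=> m; apply: nneseries_ge0 => l _ _; exact: g0.
have -> : [set: nat * nat] = setT `*`` (fun=> setT) by apply/seteqP.
pose h (m l : nat) := ((weight m.+1 * weight l.+1 : R)%:E *
  l1norm (fun c => freq R (x : seq A) (cell (floor_coding (m, l)) c)
                 - freq R (y : seq A) (cell (floor_coding (m, l)) c))%R)%E.
rewrite -[RHS](@esum_esum _ _ _ setT (fun=> setT) h); last first.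
  by move=> m l _ _; rewrite mule_ge0 ?l1norm_ge0 ?lee_fin ?mulr_ge0.
apply: eq_esum => m _; rewrite addn1 -nneseries_addn; last by move=> l; exact: g0.
rewrite nneseries_esumT//; apply: eq_esum => l _; rewrite addn1 /h; congr (_ * _)%E.
rewrite /cubes esum_image.
  by apply: eq_esum => c _; rewrite cubeE.
move=> c c' _ _; rewrite !cubeE => cc'.
have [v vc] := floors_surj m.+1 l.+1 c.
have : (floors m.+1 l.+1 @^-1` [set c]) v by [].
by rewrite cc' /= vc.
Qed.

(** Halving the side of the dyadic intervals refines them. *)
Lemma floor_double (a b : R) : Num.floor (a * 2) = Num.floor (b * 2) ->
  Num.floor a = Num.floor b.
Proof.
move=> ab; apply: floor_def.
have two : (2 : int)%:~R = 2 :> R by [].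
have /andP[b1 b2] := floor_itv b.
have : Num.floor b * 2 <= Num.floor (a * 2).
  by rewrite ab floor_ge_int rmorphM/= two ler_pM2r.
have : Num.floor (a * 2) < (Num.floor b + 1) * 2.
  by rewrite ab floor_lt_int rmorphM/= two ltr_pM2r.
rewrite floor_lt_int floor_ge_int !rmorphM/= two ltr_pM2r// ler_pM2r//.
by move=> -> ->.
Qed.

Lemma floor_close (a b s : R) : 0 < s -> Num.floor (a * s) = Num.floor (b * s) ->
  `|a - b| <= s^-1.
Proof.
move=> s0 ab; have := floor_itv (a * s); have := floor_itv (b * s); rewrite ab.
rewrite rmorphD/= => /andP[b1 b2] /andP[a1 a2].
rewrite -[leRHS]mul1r ler_pdivlMr//.
have -> : `|a - b| * s = `|a * s - b * s| by rewrite -mulrBl normrM (gtr0_norm s0).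
by rewrite ler_norml; lra.
Qed.

Lemma floor_coding_separating (mu1 mu2 : probability (borel (trajectory A)) R) :
  (forall j c, mu1 (symbol_event (floor_coding j) 0 c) =
               mu2 (symbol_event (floor_coding j) 0 c)) ->
  same_process mu1 mu2.
Proof.
move=> mu12.
apply: (fibers_determine_measure _ _ _ mu1 mu2 _
  (fun n x => symbols (floor_coding (n, n)) x 0)).
- by move=> n; exact: symbol_countable (floor_coding (n, n)).
- by move=> n c; exact: measurable_symbol_event.
- move=> n x y /= xy; apply/funext => -[i ik].
  have ik' : (i < n.+2)%N by rewrite ltnS ltnW.
  have := congr1 (fun v : 'I_n.+2 -> int => v (Ordinal ik')) xy.
  rewrite /symbols/= /floors /window /= exprSr !mulrA; exact: floor_double.
- move=> U x oU Ux; apply: (open_trajectory _ _ x _ _ oU Ux) => y yx i.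
  apply/cvgrPdist_le => e e0; near=> n.
  have ni : (i < n.+1)%N by near: n; exists i.
  have en : e^-1 <= n%:R by near: n; exact: nbhs_infty_ger.
  have := congr1 (fun v : 'I_n.+1 -> int => v (Ordinal ni)) (yx n).
  rewrite /symbols/= /floors /window /= add0n => /esym yxi.
  have s0 : (0 : R) < 2 ^+ n.+1 by rewrite exprn_gt0.
  have {}yxi := floor_close _ _ _ s0 yxi.
  apply: le_trans yxi _.
  have n0 : (0 : R) < n%:R by apply: lt_le_trans en; rewrite invr_gt0.
  rewrite -(invrK e) lef_pV2 ?posrE ?invr_gt0 ?exprn_gt0//.
  apply: (le_trans en); rewrite -natrX ler_nat.
  by rewrite ltnW// (ltn_trans (ltnSn n))// ltn_expl.
- by move=> n c; exact: mu12.
Unshelve. all: end_near. Qed.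

End real_alphabet.
Theorem theorem4p3 (R : realType) (a : alphabet)
  (theta alpha beta : R)
  (theta01 : 0 < theta < 1)
  (alpha_gt0 : 0 < alpha) (alpha_le_beta : alpha <= beta) (beta_lt1 : beta < 1)
  (change_in_range : \forall n \near \oo,
     alpha * n%:R < (change_index theta n)%:R < beta * n%:R)
  (rhoX rhoY : probability (borel (trajectory (@letter R a))) R)
  (seX : stationary_ergodic rhoX) (seY : stationary_ergodic rhoY)
  (rhoXY : ~ same_process rhoX rhoY)
  (d : measure_display) (Omega : measurableType d) (P : probability Omega R)
  (X Y : {mfun Omega >-> borel (trajectory (@letter R a))})
  (genX : generated_by P X rhoX) (genY : generated_by P Y rhoY)
  (tau : seq (@letter R a) -> nat) (tauP : argmax_rule alpha beta tau) :
  {ae P, forall w,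
    `|theta_hat tau (sample theta (X w) (Y w) n) - theta| @[n --> \oo] --> (0 : R)}.
Proof.
case: a rhoX rhoY seX seY rhoXY X Y genX genY tau tauP => [|F finF]
  rhoX rhoY seX seY rhoXY X Y genX genY tau tauP.
  apply: (argmax_consistent (@floor_coding R)
    (fun j => weight j.1.+1 * weight j.2.+1) (@countableP (nat * nat)%type setT) _ weight_prod_summable _
    theta alpha beta rhoX rhoY _ _ P X Y tau) => //.
  - by move=> j; rewrite mulr_gt0// weight_gt0.
  - exact: floor_coding_separating.
  - move=> z /(tauP z)[adm best]; split => // s /best.
    by rewrite /= !dhat_realE.
apply: (argmax_consistent (@word_coding F finF)
  (fun k => weight k.+1) (@countableP nat setT) _ _ _ theta alpha beta rhoX rhoY _ _ P X Y tau) => //.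
- by move=> k; exact: weight_gt0.
- by apply: le_lt_trans weight_summable _; exact: ltry.
- exact: word_coding_separating.
- move=> z /(tauP z)[adm best]; split => // s /best.
  by rewrite /= !(dhat_finiteE _ finF).
Qed.
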